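(* For each $t\in[0,1)$ the operator $C_t\in\mathcal{L}(\omega)$ is a bicontinuous isomorphism of $\omega$ onto itself, with inverse operator $(C_t)^{-1}:\omega\to\omega$ given by $$(C_t)^{-1}y=\big((n+1)y_n-n\,t\,y_{n-1}\big)_{n\in\mathbb{N}_0},\qquad y=(y_n)_{n\in\mathbb{N}_0}\in\omega\quad(\text{with } y_{-1}:=0).$$ In particular, $C_t$ is not a compact operator on $\omega$.
   Context: $\mathbb{N}_0=\{0,1,2,\dots\}$ and $\omega:=\mathbb{C}^{\mathbb{N}_0}$ is the Fréchet space of all complex sequences with the topology of coordinatewise convergence. $\mathcal{L}(\omega)$ is the space of continuous linear operators from $\omega$ into itself. For $t\in[0,1]$ the generalized Cesàro operator $C_t$ is $$C_tx:=\left(\frac{t^nx_0+t^{n-1}x_1+\dots+x_n}{n+1}\right)_{n\in\mathbb{N}_0},\quad x=(x_n)_{n\in\mathbb{N}_0}\in\omega,$$ with $0^0:=1$, so that $C_0x=(x_n/(n+1))_n$. A linear map $T:X\to Y$ between locally convex Hausdorff spaces is compact if there is a neighbourhood $\mathcal{U}$ of $0$ in $X$ such that $T(\mathcal{U})$ is relatively compact in $Y$. *)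

(* Defs.v *)
From HB Require Import structures.
From mathcomp Require Import all_boot all_order all_algebra.
From mathcomp Require Import complex.
From mathcomp Require Import boolp classical_sets functions reals convex.
From mathcomp Require Import topology normedtype.

Set Implicit Arguments.
Unset Strict Implicit.
Unset Printing Implicit Defensive.

Import Order.TTheory GRing.Theory Num.Theory.

Local Open Scope classical_set_scope.
Local Open Scope ring_scope.
Local Open Scope complex_scope.

(* [R[i]^o] is [R[i]] as a topological vector space over itself; the topology
   of [{ptws nat -> _}] is the one of coordinatewise convergence. The order of
   [R[i]] is partial: its positive elements are the positive reals, so that
   balls and convex sets over [R[i]] are the usual ones. *)
Definition omega (R : realType) : Type := {ptws nat -> R[i]^o}.

HB.instance Definition _ (R : realType) := Uniform.on (omega R).
HB.instance Definition _ (R : realType) :=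
  GRing.Lmodule.copy (omega R) (nat -> R[i]^o).

Section omega_tvs.
Context {R : realType}.
Implicit Types x y : omega R.

Lemma omega_eval_continuous n :
  continuous (fun y : omega R => (y n : R[i]^o)).
Proof. exact: (@proj_continuous nat (fun=> R[i]^o)). Qed.

Lemma omega_cvgP (F : set_system (omega R)) x : Filter F ->
  (F --> x) <-> (forall n, (fun y : omega R => (y n : R[i]^o)) @ F --> x n).
Proof.
move=> FF.
have eval_surj n :
    (fun y : omega R => (y n : R[i]^o)) @` [set: omega R] = [set: R[i]^o].
  by apply/seteqP; split=> // c _; exists (fun=> c).
split=> [Fx n|Fx].
  by apply: cvg_trans (cvg_app _ Fx) _; exact: omega_eval_continuous.
apply/cvg_sup => n; apply/cvg_image; first exact: eval_surj.
apply: cvg_trans (Fx n) => A FA.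
exists ((fun y : omega R => (y n : R[i]^o)) @^-1` A) => //.
exact: image_preimage.
Qed.

Lemma omega_continuousP (T : topologicalType) (f : T -> omega R) :
  continuous f <-> (forall n, continuous (fun t => (f t n : R[i]^o))).
Proof.
split=> [cf n t|cf t]; first by have /omega_cvgP := cf t; exact.
by apply/omega_cvgP => n; exact: (cf n t).
Qed.

Let omega_add_continuous : continuous (fun z : omega R * omega R => z.1 + z.2).
Proof.
apply/omega_continuousP => n z.
have c1 : (fun z : omega R * omega R => (z.1 n : R[i]^o)) @ z --> z.1 n.
  by apply: (cvg_comp fst (fun x : omega R => x n : R[i]^o));
    [exact: cvg_fst|exact: omega_eval_continuous].
have c2 : (fun z : omega R * omega R => (z.2 n : R[i]^o)) @ z --> z.2 n.
  by apply: (cvg_comp snd (fun x : omega R => x n : R[i]^o));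
    [exact: cvg_snd|exact: omega_eval_continuous].
exact: (cvgD c1 c2).
Qed.

Let omega_scale_continuous :
  continuous (fun z : R[i]^o * omega R => z.1 *: z.2).
Proof.
apply/omega_continuousP => n z.
have c1 : (fun z : R[i]^o * omega R => z.1) @ z --> z.1 by exact: cvg_fst.
have c2 : (fun z : R[i]^o * omega R => (z.2 n : R[i]^o)) @ z --> z.2 n.
  by apply: (cvg_comp snd (fun x : omega R => x n : R[i]^o));
    [exact: cvg_snd|exact: omega_eval_continuous].
exact: (cvgZ c1 c2).
Qed.

Let omega_locally_convex : exists2 B : set_system (omega R),
  (forall b, b \in B -> convex_set b) & basis B.
Proof.
exists [set b | open b /\ convex_set b] => [b /[!inE] -[]//|].
split=> [b []//|x].
have FF : Filter (filter_from
    [set U : set (omega R) | (open U /\ convex_set U) /\ U x] id).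
  apply: filter_from_filter.
    exists setT; split=> //; split; first exact: openT.
    by move=> ? ? ? _ _; rewrite inE.
  move=> A B [[oA cA] Ax] [[oB cB] Bx]; exists (A `&` B) => //.
  split=> //; split; first exact: openI.
  move=> a b l /[!inE] -[Aa Ba] [Ab Bb].
  by split; apply/set_mem; [apply: cA|apply: cB]; exact/mem_set.
apply/omega_cvgP => n A xA.
have [B cB [oB bB]] := @locally_convex _ R[i]^o.
have [b [Bb xb] bA] := bB _ _ xA.
exists ((fun y : omega R => (y n : R[i]^o)) @^-1` b); last by move=> y /bA.
split=> //; split.
  by apply: open_comp => [y _|]; [exact: omega_eval_continuous|exact: oB].
move=> y z l /[!inE] yb zb; apply/set_mem.
by apply: cB; exact/mem_set.
Qed.

HB.instance Definition _ := PreTopologicalNmodule_isTopologicalNmodule.Build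
  (omega R) omega_add_continuous.
HB.instance Definition _ := TopologicalNmodule_isTopologicalLmodule.Build
  R[i] (omega R) omega_scale_continuous.
HB.instance Definition _ :=
  Uniform_isTvs.Build R[i] (omega R) omega_locally_convex.

End omega_tvs.

Section operators.
Context {K : numFieldType} {E F : tvsType K}.

Definition continuous_linear (f : E -> F) : Prop := linear f /\ continuous f.

(* To be applied to linear maps. *)
Definition compact_operator (f : E -> F) : Prop :=
  exists2 U : set E, nbhs 0 U & compact (closure (f @` U)).

End operators.

Definition bicontinuous_isomorphism {K : numFieldType} {E F : tvsType K}
    (f : E -> F) : Prop :=
  continuous_linear f /\
  exists g : F -> E, [/\ continuous_linear g, cancel f g & cancel g f].

(* At [t = 0], [0 ^+ 0 = 1] makes this the diagonal operator [x n / (n + 1)]. *)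
Definition cesaro {R : realType} (t : R) (x : omega R) : omega R :=
  fun n => (\sum_(i < n.+1) (t ^+ (n - i))%:C * x i) / n.+1%:R.

(* The [match] encodes [y (n - 1)] with the convention that [y (- 1) = 0]. *)
Definition cesaro_inv {R : realType} (t : R) (y : omega R) : omega R :=
  fun n => n.+1%:R * y n - n%:R * t%:C * (if n is m.+1 then y m else 0).

(* Main.v *)
(* The numerators of [cesaro t x] satisfy S n.+1 = t * S n + x n.+1, whence both
   cancellations. For non-compactness: a neighbourhood U of 0 contains a whole
   coordinate line, since otherwise one could pick on each coordinate axis a
   point outside U, and these points converge to 0. The corresponding coordinate
   maps the image of U onto R[i], which is not compact. *)
Require Import Defs.
From mathcomp Require Import all_boot all_order all_algebra.
From mathcomp Require Import complex.
From mathcomp Require Import boolp classical_sets functions reals convex.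
From mathcomp Require Import topology normedtype.

Set Implicit Arguments.
Unset Strict Implicit.
Unset Printing Implicit Defensive.

Import Order.TTheory GRing.Theory Num.Theory.

Local Open Scope classical_set_scope.
Local Open Scope ring_scope.
Local Open Scope complex_scope.

Section cesaro_theory.
Context {R : realType}.
Variable t : R.
Implicit Types x y : omega R.

Definition cesaro_num (n : nat) x : R[i] :=
  \sum_(i < n.+1) (t ^+ (n - i))%:C * x i.

Lemma cesaro_num0 x : cesaro_num 0 x = x 0%N.
Proof. by rewrite /cesaro_num big_ord1 subnn expr0 mul1r. Qed.

(** The last summand carries the weight [t ^+ 0 = 1], and a factor [t] comes out of all the
    others. *)
Lemma cesaro_numS n x : cesaro_num n.+1 x = t%:C * cesaro_num n x + x n.+1.
Proof.
rewrite /cesaro_num big_ord_recr /= subnn expr0 mul1r mulr_sumr; congr (_ + _).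
apply: eq_bigr => i _; rewrite subSn; last by rewrite -ltnS.
by rewrite exprS rmorphM mulrA.
Qed.

Lemma cesaroE n x : cesaro t x n = cesaro_num n x / n.+1%:R.
Proof. by []. Qed.

Lemma cesaroK : cancel (cesaro t) (cesaro_inv t).
Proof.
move=> x; apply/funext => -[|n]; rewrite /cesaro_inv !cesaroE.
  by rewrite cesaro_num0 invr1 mulr1 mul1r !mul0r subr0.
(* Once [n.+2] cancels, the recursion leaves [t * cesaro_num n x + x n.+1]; the subtracted term
   reduces to [t * cesaro_num n x]. *)
rewrite mulrCA mulfV ?pnatr_eq0// mulr1 cesaro_numS.
rewrite [_ * t%:C]mulrC -mulrA [n.+1%:R * _]mulrC divfK ?pnatr_eq0//.
by rewrite addrC addKr.
Qed.

(** By induction: the term subtracted in [cesaro_inv] is [t] times the previous numerator, so the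
    recursion cancels it. *)
Lemma cesaro_num_inv n y : cesaro_num n (cesaro_inv t y) = n.+1%:R * y n.
Proof.
elim: n => [|n IH].
  by rewrite cesaro_num0 /cesaro_inv !mul0r subr0.
by rewrite cesaro_numS IH /cesaro_inv mulrCA mulrA addrC subrK.
Qed.

Lemma cesaro_invK : cancel (cesaro_inv t) (cesaro t).
Proof.
move=> y; apply/funext => n.
by rewrite cesaroE cesaro_num_inv mulrAC mulfV ?pnatr_eq0// mul1r.
Qed.

Lemma cesaro_linear : linear (cesaro t).
Proof.
move=> a x y; apply/funext => n.
transitivity ((a : R[i]) * cesaro_num n x / n.+1%:R + cesaro_num n y / n.+1%:R);
  last by rewrite -mulrA.
rewrite -mulrDl cesaroE; congr (_ / _).
rewrite mulr_sumr -big_split; apply: eq_bigr => i _ /=.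
by rewrite mulrCA -mulrDr.
Qed.

(** Inherited from [cesaro] through the two cancellations, without a case split on the index. *)
Lemma cesaro_inv_linear : linear (cesaro_inv t).
Proof.
move=> a x y; apply: (canLR cesaroK).
by rewrite cesaro_linear !cesaro_invK.
Qed.

(** The recursion builds each numerator from coordinate evaluations, with one scaling and one
    addition per step. *)
Lemma cesaro_num_continuous n :
  continuous (fun x => cesaro_num n x : R[i]^o).
Proof.
elim: n => [|n IH].
  rewrite (_ : (fun x => _) = fun x => x 0%N : R[i]^o).
    exact: omega_eval_continuous.
  by apply/funext => x; exact: cesaro_num0.
rewrite (_ : (fun x => _) =
    (fun x => t%:C *: (cesaro_num n x : R[i]^o) + (x n.+1 : R[i]^o))).
  move=> x.
  exact: (cvgD (cvgZl_tmp (k := t%:C) (IH x)) (@omega_eval_continuous R n.+1 x)).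
by apply/funext => x; exact: cesaro_numS.
Qed.

Lemma cesaro_continuous : continuous (cesaro t).
Proof.
apply/omega_continuousP => n.
rewrite (_ : (fun x => _) = (fun x => n.+1%:R^-1 *: (cesaro_num n x : R[i]^o))).
  by move=> x; exact: (cvgZl_tmp (@cesaro_num_continuous n x)).
by apply/funext => x; rewrite cesaroE mulrC.
Qed.

Lemma cesaro_inv_continuous : continuous (cesaro_inv t).
Proof.
apply/omega_continuousP => n.
rewrite (_ : (fun x => _) = (fun x => n.+1%:R *: (x n : R[i]^o) -
    (n%:R * t%:C) *: ((if n is m.+1 then x m else 0) : R[i]^o))) //.
move=> x; apply: (cvgB (cvgZl_tmp (@omega_eval_continuous R n x)) (cvgZl_tmp _)).
(* At index 0 the shifted coordinate is the constant 0. *)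
case: n => [|n]; first exact: cvg_cst.
exact: omega_eval_continuous.
Qed.

End cesaro_theory.

Definition omega_unit {R : realType} (n : nat) (c : R[i]) : omega R :=
  fun k => if k == n then c else 0.

(** Only the diagonal summand survives, with weight [t ^+ 0 = 1] even at [t = 0]; hence the value
    ranges over all of [R[i]] as [c] does. *)
Lemma cesaro_unit (R : realType) (t : R) n (c : R[i]) :
  cesaro t (omega_unit n c) n = c / n.+1%:R.
Proof.
rewrite /cesaro /omega_unit big_ord_recr /= subnn expr0 mul1r eqxx.
by rewrite big1 ?add0r// => i _; rewrite ltn_eqF// mulr0.
Qed.

Lemma nbhs0_omega_line (R : realType) (U : set (omega R)) :
  nbhs (0 : omega R) U -> exists n, forall c, U (omega_unit n c).
Proof.
move=> U0; apply: contrapT => /forallNP noline.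
have /choice[c Uc] n : exists c, ~ U (omega_unit n c).
  exact/existsNP/noline.
have c0 : (fun n => omega_unit n (c n)) @ \oo --> (0 : omega R).
  (* Coordinate [k] vanishes from index [k.+1] on, however large the [c n] are. *)
  apply/omega_cvgP => k; apply: cvg_near_cst; exists k.+1 => // n /= kn.
  by rewrite /omega_unit ltn_eqF.
by have [N _ /(_ N (leqnn N))] := c0 _ U0; exact: Uc.
Qed.

(* A cluster point of the naturals would be within 1/2 of two of them. *)
Lemma complex_not_compact (R : realType) : ~ compact [set: R[i]^o].
Proof.
move=> /(_ ((fun k : nat => k%:R : R[i]^o) @ \oo) _ filterT)[z [_ clz]].
have zB : nbhs z (ball z (2%:R^-1 : R[i])).
  by apply: nbhsx_ballx; rewrite invr_gt0 ltr0n.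
have tail N : ((fun k : nat => k%:R : R[i]^o) @ \oo)
    [set k%:R | k in [set k : nat | (N <= k)%N]].
  by exists N => // k /= Nk; exists k.
have [_ [[k _ <-] zk]] := clz _ _ (tail 0%N) zB.
(* Drawing [j] from the tail beyond [k] makes the two naturals distinct. *)
have [_ [[j /= kj <-] zj]] := clz _ _ (tail k.+1) zB.
have : `|j%:R - k%:R : R[i]| < 2^-1 + 2^-1.
  rewrite (le_lt_trans (ler_distD (z : R[i]) _ _))// distrC.
  exact: (ltrD (zj : `|_ - _| < _) zk).
have <- : 1 = 2^-1 + 2^-1 :> R[i] by rewrite [LHS]splitr mul1r.
by rewrite -natrB ?(ltnW kj)// normr_nat ltrn1 ltnS leqn0 subn_eq0 leqNgt kj.
Qed.

Lemma cesaro_not_compact (R : realType) (t : R) :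
  ~ compact_operator (cesaro t).
Proof.
move=> [U /nbhs0_omega_line[n Un] cK].
apply: (@complex_not_compact R).
rewrite (_ : [set: R[i]^o] =
    (fun y : omega R => (y n : R[i]^o)) @` closure (cesaro t @` U)).
  apply: continuous_compact => //.
  exact/continuous_subspaceT/omega_eval_continuous.
apply/esym/seteqP; split=> // c _.
(* The factor [n.+1] undoes the division, so every [c] is attained on the line inside [U]. *)
exists (cesaro t (omega_unit n (c * n.+1%:R))).
  by apply: subset_closure; exists (omega_unit n (c * n.+1%:R)).
by rewrite cesaro_unit mulfK ?pnatr_eq0.
Qed.

Theorem proposition3p2 (R : realType) (t : R) :
  0 <= t < 1 ->
  [/\ bicontinuous_isomorphism (cesaro t),
      cancel (cesaro t) (cesaro_inv t),
      cancel (cesaro_inv t) (cesaro t)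
    & ~ compact_operator (cesaro t)].
Proof.
move=> _; split; [|exact: cesaroK|exact: cesaro_invK|exact: cesaro_not_compact].
split; first by split; [exact: cesaro_linear|exact: cesaro_continuous].
exists (cesaro_inv t); split; [|exact: cesaroK|exact: cesaro_invK].
by split; [exact: cesaro_inv_linear|exact: cesaro_inv_continuous].
Qed.
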